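(* Suppose that the covering graph of $(S, \preceq)$ is a rooted tree with root $e$, and let $\boldsymbol{X}$ be a recurrent upward run chain on $S$ with transition function $P$ and standard invariant function $F(x) = \mathbb{P}_e(T_x \le T_e)$. Then: (i) $F$ is the upper probability function of $X_{T_e - 1}$ given $X_0 = e$: $F(x) = \mathbb{P}_e(X_{T_e - 1} \succeq x)$ for $x \in S$; (ii) $\mathbb{E}_e(T_e) = \sum_{x\in S}F(x) = 1 + \mathbb{E}_e[d(e, X_{T_e - 1})]$; (iii) if the chain is positive recurrent, then the invariant probability density function $f$ is the same as the probability density function of $X_{T_e-1}$ given $X_0 = e$ if and only if the invariant distribution has constant rate.
   Context: $(S, \preceq)$ is a discrete (countable) partially ordered set with a minimum element $e$, such that for every $x \in S$ every chain (totally ordered subset) in $S$ from $e$ to $x$ is finite. An element $y$ covers $x$ if $y$ is a minimal element of $\{t \in S : t \succ x\}$; $A_x = \{y \in S : y \text{ covers } x\}$. The covering graph is the directed graph on $S$ with an edge $(x,y)$ whenever $y$ covers $x$. When it is a rooted tree, $d(e,x)$ is the length of the unique path from $e$ to $x$. An upward run chain is a (time-homogeneous, discrete-time) Markov chain $(X_0, X_1, \ldots)$ on $S$ whose transition function $P$ satisfies $P(x,y) > 0$ if and only if $y \in A_x$ or $y = e$. $\mathbb{P}_e$, $\mathbb{E}_e$ denote probability and expectation given $X_0 = e$, and $T_x = \min\{n \ge 1 : X_n = x\}$. For a random variable $Z$ with support $S$, the probability density function is $f(x) = \mathbb{P}(Z = x)$, the upper probability function is $x \mapsto \mathbb{P}(Z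 \succeq x)$, and the rate function is $r(x) = \mathbb{P}(Z=x)/\mathbb{P}(Z \succeq x)$; the distribution has constant rate if $r$ is constant on $S$. *)

(* Defs.v *)
From HB Require Import structures.
From mathcomp Require Import all_boot all_order all_algebra.
From mathcomp Require Import all_classical all_reals all_analysis.
Set Implicit Arguments.
Unset Strict Implicit.
Unset Printing Implicit Defensive.
Import Order.TTheory GRing.Theory Num.Theory.
Local Open Scope classical_set_scope.
Local Open Scope ring_scope.

Section Order.
Context {dS : Order.disp_t} {S : porderType dS}.

Definition minimal_element (A : set S) (y : S) : Prop :=
  A y /\ forall t, A t -> (t <= y)%O -> t = y.

(* [cover_set x] is the set A_x of the elements covering [x]. *)
Definition cover_set (x : S) : set S :=
  [set y | minimal_element [set t | (x < t)%O] y].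

Definition finite_chains (e : S) : Prop :=
  forall (x : S) (C : set S),
    total_on C (fun a b => (a <= b)%O : Prop) ->
    C e -> C x -> (forall a, C a -> (e <= a)%O /\ (a <= x)%O) ->
    finite_set C.

Definition cover_edge : rel S := fun x y => `[< cover_set x y >].

(* A path from [e] to [x] in the covering graph is given by the sequence of
   its vertices other than [e], so that its length is the size of the
   sequence. *)
Definition cover_path (e x : S) (p : seq S) : Prop :=
  path cover_edge e p /\ last e p = x.

(* The directed graph is a tree rooted at [e], with edges directed away from
   the root: every vertex is reached from [e] by exactly one path. *)
Definition rooted_tree (e : S) : Prop :=
  forall x : S, exists! p : seq S, cover_path e x p.

(* [xget] returns the unique path from [e] to [x] when [rooted_tree e]. *)
Definition tree_dist (e x : S) : nat := size (xget [::] (cover_path e x)).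

End Order.

Section Distribution.
Context {R : realType} {dS : Order.disp_t} {S : porderType dS}.

Definition prob_density (f : S -> R) : Prop :=
  (forall x, 0 <= f x) /\ (\esum_(x in [set: S]) (f x)%:E = 1)%E.

(* For the distribution with density [f], [upper_prob f x] is the probability
   of the set of the elements above [x]. *)
Definition upper_prob (f : S -> R) (x : S) : R :=
  fine (\esum_(y in [set y | (x <= y)%O]) (f y)%:E)%E.

Definition rate (f : S -> R) (x : S) : R := f x / upper_prob f x.

Definition constant_rate (f : S -> R) : Prop :=
  exists c : R, forall x, rate f x = c.

Definition transition_function (P : S -> S -> R) : Prop :=
  forall x, prob_density (P x).

Definition upward_run (e : S) (P : S -> S -> R) : Prop :=
  forall x y, 0 < P x y <-> cover_set x y \/ y = e.

Definition invariant_density (P : S -> S -> R) (f : S -> R) : Prop :=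
  prob_density f /\
  forall y, (\esum_(x in [set: S]) (f x * P x y)%:E = (f y)%:E)%E.

End Distribution.

Section Chain.
Context {R : realType} {dS : Order.disp_t} {S : porderType dS}
  {d : measure_display} {Omega : measurableType d}.
Variables (Pr : S -> probability Omega R) (X : nat -> Omega -> S).

(* [S] carries the discrete sigma-algebra; since [S] is countable it is enough
   that the events [X n = x] be measurable.  Under [Pr x] the process starts
   at [x], and the Markov property is the conditional probability
   Pr x (X_(n+1) = s_(n+1) | X_0 = s_0, ..., X_n = s_n) = P s_n s_(n+1)
   multiplied out by the probability of the conditioning event. *)
Definition markov_chain (P : S -> S -> R) : Prop :=
  [/\ transition_function P,
      forall n x, measurable [set w | X n w = x],
      forall x, Pr x [set w | X 0%N w = x] = 1%E
    & forall (x : S) (n : nat) (s : nat -> S),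
        (Pr x [set w | forall k, (k <= n.+1)%N -> X k w = s k] =
         Pr x [set w | forall k, (k <= n)%N -> X k w = s k] *
           (P (s n) (s n.+1))%:E)%E].

(* T_x, the least n >= 1 with X_n = x; it is +oo if there is no such n. *)
Definition hitting_time (x : S) (w : Omega) : \bar R :=
  ereal_inf [set n%:R%:E | n in [set n : nat | (1 <= n)%N /\ X n w = x]].

(* X_(T_e - 1); the junk value X_0 is taken on the event T_e = +oo, which has
   probability 0 under [Pr e] when the chain is recurrent. *)
Definition before_return (e : S) (w : Omega) : S :=
  X (Num.truncn (fine (hitting_time e w))).-1 w.

Definition recurrent : Prop :=
  forall x, Pr x [set w | (hitting_time x w < +oo)%E] = 1%E.

Definition positive_recurrent : Prop :=
  forall x, (\int[Pr x]_w hitting_time x w < +oo)%E.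

(* F(x) = P_e(T_x <= T_e). *)
Definition std_invariant (e x : S) : \bar R :=
  Pr e [set w | (hitting_time x w <= hitting_time e w)%E].

End Chain.

Arguments hitting_time R {dS S d Omega} X x w.
Arguments before_return R {dS S d Omega} X e w.

(* Main.v *)
Require Import Defs.
From HB Require Import structures.
From mathcomp Require Import all_boot all_order all_algebra.
From mathcomp Require Import all_classical all_reals all_analysis.
From mathcomp Require Import measurable_realfun.
Set Implicit Arguments.
Unset Strict Implicit.
Unset Printing Implicit Defensive.
Import Order.TTheory GRing.Theory Num.Theory.
Local Open Scope classical_set_scope.
Local Open Scope ring_scope.

(** Write [T] for the first return time of the chain to [e], and [Y] for the state
    [X_(T-1)] from which the chain returns.  A step of an upward run chain goes to
    an element that covers the current state or back to [e]; hence, almost surely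
    under [Pr e], the states [X_1, ..., X_(T-1)] are the vertices of a path from
    [e] to [Y] in the covering graph, and in a rooted tree there is only one such
    path ([ae_excursion]).  Everything else is read off this picture.

    (i) The chain visits [x] before returning to [e] iff [x] lies on the path to
    [Y].  The elements of that path are exactly those below [Y]
    ([le_mem_tree_path]): an inequality [x <= Y] can be refined into a path of
    covers because chains are finite ([le_cover_path]), and by uniqueness this
    path extends the one from [e] to [x].

    (ii) The path to [Y] has length [T - 1], so [T = 1 + d(e, Y)], which is also
    the number of elements below [Y].  Writing this number as the sum over [x] of
    the indicators of [x <= Y] and exchanging sum and integral gives the sum of
    the probabilities [F(x)] of (i).

    (iii) If [y] covers [x], then [x] is the only state from which [y] can be
    entered, so an invariant [f] satisfies [f y = f x * P x y].  By the Markov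
    property along the path to [y], [F] satisfies the same recursion
    ([upper_cover]), and [F e = 1]; hence [f = f(e) F] ([invariant_upper]).  Since [F] is
    the upper probability function of [Y], the rate of [f] is the constant [f(e)]
    as soon as [f] is the density of [Y].  Conversely, a constant rate has to be
    the value [f(e)] that it takes at [e], so the upper probability function of
    [f] is also [F].  An upper probability function on a tree determines its
    density, because the elements above [x] are [x] and, disjointly, the elements
    above each cover of [x] ([esum_above]). *)

(** * Paths and order in the covering graph *)

Section Tree.
Context {dS : Order.disp_t} {S : porderType dS} (e : S).
Hypothesis hmin : forall x : S, (e <= x)%O.
Hypothesis hchains : finite_chains e.

(** Otherwise one could move along [r] forever inside [A]; together with [e] and
    [y], the elements visited would form an infinite chain from [e] to [y].  The
    relation [r] is used both for [<] and for [>], so that maximal and minimal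
    elements are obtained at once. *)
Lemma chain_end (r : rel S) (y : S) (A : set S) :
  transitive r -> irreflexive r ->
  (forall a b, r a b -> (a <= b)%O \/ (b <= a)%O) ->
  A !=set0 -> (forall a, A a -> (a <= y)%O) ->
  exists2 a, A a & forall b, A b -> ~ r a b.
Proof.
move=> tr ir comp [a0 Aa0] Ay; apply: contrapT => nomax.
have next (a : S) : exists b, A a -> A b /\ r a b.
  have [Aa|nAa] := pselect (A a); last by exists a.
  apply: contrapT => H; apply: nomax; exists a => // b Ab rab.
  by apply: H; exists b.
have [f fP] := choice next; pose u n := iter n f a0.
have Au n : A (u n) by elim: n => //= n /fP[].
have ru m n : (m < n)%N -> r (u m) (u n).
  elim: n => // n IH; rewrite ltnS leq_eqVlt => /predU1P[->|/IH rmn].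
    by have [] := fP _ (Au n).
  by apply: tr rmn _; have [] := fP _ (Au n).
have uinj : injective u.
  by move=> m n umn; have [/ru|/ru|//] := ltngtP m n; rewrite umn ir.
pose C := [set e; y] `|` range u.
have Cy a : C a -> (a <= y)%O by move=> [[->|->]|[n _ <-]]; [exact: hmin| |exact: Ay].
have Ctot : total_on C (fun a b => (a <= b)%O : Prop).
  move=> a b Ca Cb; case: (Ca) => [[->|->]|[m _ <-]].
  - by left; exact: hmin.
  - by right; exact: Cy.
  case: (Cb) => [[->|->]|[n _ <-]].
  - by right; exact: hmin.
  - by left; exact: Ay.
  have [/ru/comp//|/ru/comp[]|->] := ltngtP m n; [by right|by left|by left].
have finC : finite_set C.
  apply: (hchains Ctot); [by left; left|by left; right|].
  by move=> a /Cy.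
have : finite_set (range u) by apply: sub_finite_set finC => a; right.
rewrite (eq_finite_set (inj_card_eq _)); last by move=> ? ? _ _ /uinj.
exact: infinite_nat.
Qed.

Lemma cover_edgeP (x y : S) : reflect (cover_set x y) (cover_edge x y).
Proof. exact: asboolP. Qed.

Lemma cover_lt (x y : S) : cover_set x y -> (x < y)%O.
Proof. by case. Qed.

Lemma cover_path_sorted (x : S) (p : seq S) :
  path cover_edge x p -> path <%O x p.
Proof. by apply: sub_path => a b /cover_edgeP/cover_lt. Qed.

(** Take a maximal [z] below [y] among the elements reachable from [x].  If [z]
    were not [y], a minimal element of the interval from [z] (excluded) to [y]
    would cover [z] and be reachable as well. *)
Lemma le_cover_path (x y : S) :
  (x <= y)%O -> exists2 p, path cover_edge x p & last x p = y.
Proof.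
move=> xy.
pose B : set S := [set z | (z <= y)%O /\ exists2 p, path cover_edge x p & last x p = z].
have [z [zy [p pp pz]] zmax] : exists2 a, B a & forall b, B b -> ~ (a < b)%O.
  apply: (@chain_end <%O y) => //.
  - exact: lt_trans.
  - by move=> a b /ltW; left.
  - by exists x; split=> //; exists [::].
  - by move=> a [].
have [zEy|zNy] := eqVneq z y; first by exists p; rewrite ?pz.
pose A : set S := [set t | (z < t <= y)%O].
have [t /andP[zt ty] tmin] : exists2 a, A a & forall b, A b -> ~ (b < a)%O.
  apply: (@chain_end >%O y) => //.
  - by move=> a b c ba cb; exact: lt_trans cb ba.
  - by move=> a; exact: (ltxx a).
  - by move=> a b /ltW; right.
  - by exists y; rewrite /A /= lexx andbT lt_neqAle zNy.
  - by move=> a /andP[].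
exfalso; apply: (zmax t) => //; split=> //.
exists (rcons p t); last by rewrite last_rcons.
rewrite rcons_path pp pz; apply/cover_edgeP; split=> // s zs st.
apply/eqP; move: st; rewrite le_eqVlt => /predU1P[->//|st].
by exfalso; apply: (tmin s) => //; rewrite /A /= zs (le_trans (ltW st)).
Qed.

Hypothesis htree : rooted_tree e.

Definition tree_path (x : S) : seq S := xget [::] (cover_path e x).

Lemma tree_pathP (x : S) : cover_path e x (tree_path x).
Proof. by have [p [pP _]] := htree x; apply: (xgetPex [::]); exists p. Qed.

Lemma tree_path_uniq (x : S) (p : seq S) : cover_path e x p -> p = tree_path x.
Proof.
by have [q [_ qP]] := htree x => px; rewrite -(qP _ px) -(qP _ (tree_pathP x)).
Qed.

Lemma last_tree_path (x : S) : last e (tree_path x) = x.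
Proof. by have [] := tree_pathP x. Qed.

(** Uniqueness of paths: continuing the path to [x] gives the path to any element
    reachable from [x]. *)
Lemma tree_path_cat (x : S) (p : seq S) :
  path cover_edge x p -> tree_path (last x p) = tree_path x ++ p.
Proof.
move=> pp; apply/esym/tree_path_uniq; split; last first.
  by rewrite last_cat last_tree_path.
by rewrite cat_path last_tree_path pp andbT; case: (tree_pathP x).
Qed.

Lemma tree_path_cover (x y : S) : cover_set x y -> tree_path y = rcons (tree_path x) y.
Proof.
by move=> xy; rewrite -cats1 -(@tree_path_cat x [:: y]) //= andbT; exact/cover_edgeP.
Qed.

Lemma cover_parent (x x' y : S) : cover_set x y -> cover_set x' y -> x = x'.
Proof.
move=> /tree_path_cover + /tree_path_cover => -> /rcons_inj[].
by move=> /(congr1 (last e)); rewrite !last_tree_path.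
Qed.

(** From left to right, a path of covers from [x] to [y] extends the path to [x],
    so the latter is a prefix of the path to [y]. *)
Lemma le_mem_tree_path (x y : S) : (x <= y)%O = (x \in e :: tree_path y).
Proof.
apply/idP/idP => [xy|].
  have [p pp <-] := le_cover_path xy; rewrite (tree_path_cat pp).
  by rewrite -cat_cons mem_cat -{1}(last_tree_path x) mem_last.
have [/cover_path_sorted + +] := tree_pathP y => + + /splitPl px.
case: px => p1 p2 <-; rewrite cat_path last_cat => /andP[_ pp] <-.
move: pp; rewrite lt_path_sortedE => /andP[/allP H _].
case: p2 H => [|a p2] H //=.
by apply: ltW; apply: H; rewrite mem_last.
Qed.

Lemma uniq_tree_path (y : S) : uniq (e :: tree_path y).
Proof.
have [/cover_path_sorted pp _] := tree_pathP y.
by apply: (sorted_uniq lt_trans ltxx); exact: pp.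
Qed.

(** The path to [t] continues the path to [x] through both [y] and [y']. *)
Lemma above_cover_uniq (x y y' t : S) :
  cover_set x y -> cover_set x y' -> (y <= t)%O -> (y' <= t)%O -> y = y'.
Proof.
move=> xy xy' /le_cover_path[p pp <-] /le_cover_path[p' pp' /esym pt].
move: (congr1 tree_path pt); rewrite !tree_path_cat//.
rewrite !(tree_path_cover xy) !(tree_path_cover xy') !cat_rcons.
by move/eqP; rewrite eqseq_cat// eqxx /= eqseq_cons => /andP[/eqP].
Qed.

Lemma lt_cover_le (x t : S) : (x < t)%O -> exists2 y, cover_set x y & (y <= t)%O.
Proof.
move=> /[dup] xt /ltW/le_cover_path[[|y p] /=].
  by move=> _ E; rewrite E ltxx in xt.
move=> /andP[/cover_edgeP xy pp] <-; exists y => //.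
move: pp => /cover_path_sorted; rewrite lt_path_sortedE => /andP[/allP H _].
by have := mem_last y p; rewrite inE => /predU1P[->//|/H/ltW].
Qed.

Lemma tree_ind (K : S -> Prop) :
  K e -> (forall x y, cover_set x y -> K x -> K y) -> forall x, K x.
Proof.
move=> Ke Kcover x; rewrite -(last_tree_path x).
have [+ _] := tree_pathP x; elim/last_ind: (tree_path x) => [//|p y IH].
rewrite rcons_path last_rcons => /andP[/IH Kp /cover_edgeP py].
exact: Kcover py Kp.
Qed.

End Tree.

(** * Sums over a rooted tree *)

Section SumAbove.
Context {R : realType} {dS : Order.disp_t} {S : porderType dS} (e : S).
Hypothesis hmin : forall x : S, (e <= x)%O.
Hypothesis hchains : finite_chains e.
Hypothesis htree : rooted_tree e.

(** Above [x] there are [x] itself and, disjointly by [above_cover_uniq], the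
    elements above each cover of [x].  The recursion shows that a density is
    determined by its upper probability function. *)
Lemma esum_above (h : S -> \bar R) (x : S) : (forall t, 0 <= h t)%E ->
  (\esum_(t in [set t | (x <= t)%O]) h t =
   h x + \esum_(y in cover_set x) \esum_(t in [set t | (y <= t)%O]) h t)%E.
Proof.
move=> h0; rewrite [LHS](esumID [set x])//; congr (_ + _)%E.
  rewrite [X in esum X](_ : _ = [set x]) ?esum_set1//.
  by apply/seteqP; split=> [t [_ ->]|_ ->]; [|split=> /=].
rewrite esum_esum// -(@esum_image _ _ _ _ snd h); last first.
  move=> [y t] [y' t']; rewrite !inE /= => -[/= xy yt] [/= xy' yt'] tt'.
  by rewrite -tt' in yt' *; rewrite (above_cover_uniq hmin hchains htree xy xy' yt yt').
congr esum; apply/seteqP; split=> [t [/= xt tx]|t /= [[y s] [/= xy ys] <-]].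
  have {}xt : (x < t)%O by rewrite lt_neqAle xt andbT eq_sym; apply/eqP.
  by have [y xy yt] := lt_cover_le hmin hchains xt; exists (y, t).
have xs := lt_le_trans (cover_lt xy) ys; split; first exact: ltW.
by move=> E; move: xs; rewrite E ltxx.
Qed.

(** The elements below [y] are the vertices of the path from [e] to [y], and there
    is one more of them than edges. *)
Lemma esum_below (y : S) :
  (\esum_(x in [set: S]) (if (x <= y)%O then 1 else 0) =
    1 + (tree_dist e y)%:R%:E :> \bar R)%E.
Proof.
transitivity (\esum_(x in [set` e :: tree_path e y]) 1 : \bar R)%E.
  rewrite [RHS]esum_mkcond; apply: eq_esum => x _.
  by rewrite mem_setE -le_mem_tree_path.
rewrite esum_fset//; last exact: finite_seq.
rewrite -fsbig_seq; last exact: uniq_tree_path.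
by rewrite sumEFin big_const_seq count_predT /= iter_addr_0 EFinD.
Qed.

End SumAbove.

(** * Random variables with values in a countable type *)

Section Countable.
Context {R : realType} {C : choiceType} {d : measure_display} {Omega : measurableType d}.
Hypothesis hcountable : countable [set: C].
Implicit Types (mu : {measure set Omega -> \bar R}) (A : set C) (Z : Omega -> C).

(** An injection of [C] into [nat] cuts [A] into fibres with at most one element,
    which reduces the claim to series indexed by [nat]. *)
Lemma integral_esum mu A (f : C -> Omega -> \bar R) :
  (forall c, measurable_fun [set: Omega] (f c)) -> (forall c w, 0 <= f c w)%E ->
  (\int[mu]_w (\esum_(c in A) f c w) = \esum_(c in A) \int[mu]_w f c w)%E.
Proof.
move=> mf f0; have /countable_injP[g ginj] := hcountable.
pose F n := A `&` [set c | g c = n].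
have AE : A = \bigcup_n F n.
  by apply/seteqP; split=> [c Ac|c [n _ []//]]; exists (g c).
have tF : trivIset [set: nat] F.
  by move=> m n _ _ [c [[_ /= <-] [_ /= <-]]].
have FE n : F n = set0 \/ exists c, F n = [set c].
  have [->|/set0P[c [Ac gc]]] := eqVneq (F n) set0; [by left|right; exists c].
  apply/seteqP; split=> [c' [_ /= gc']|_ ->//].
  by apply: ginj; rewrite ?inE//; rewrite gc gc'.
rewrite AE; under eq_integral do rewrite nneseries_sum_bigcup//.
rewrite nneseries_sum_bigcup//; last by move=> c; apply: integral_ge0.
rewrite integral_nneseries//.
- apply: eq_eseriesr => n _; have [->|[c ->]] := FE n.
    by rewrite esum_set0; apply: integral0_eq => w _; rewrite esum_set0.
  rewrite esum_set1; last exact: integral_ge0.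
  by apply: eq_integral => w _; rewrite esum_set1.
- move=> n; have [->|[c ->]] := FE n.
    by under eq_fun do rewrite esum_set0; exact: measurable_cst.
  by rewrite (_ : (fun w => _) = f c)//; apply/funext => w; rewrite esum_set1.
- by move=> n w _; exact: esum_ge0.
Qed.

Lemma measurable_preimage Z A :
  (forall c, measurable [set w | Z w = c]) -> measurable [set w | A (Z w)].
Proof.
move=> mZ; rewrite (_ : [set w | A (Z w)] =
    \bigcup_c (if c \in A then [set w | Z w = c] else set0)).
  by apply: countable_bigcupT_measurable => // c; case: ifP.
apply/seteqP; split=> [w /= AZ|w [c _]]; first by exists (Z w); rewrite ?mem_set.
by case: ifPn => //; rewrite inE /= => + ->.
Qed.

Lemma measurable_comp_countable d' (T : measurableType d') Z (h : C -> T) :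
  (forall c, measurable [set w | Z w = c]) ->
  measurable_fun [set: Omega] (fun w => h (Z w)).
Proof.
move=> mZ _ B mB; rewrite setTI.
exact: (@measurable_preimage Z (fun c => B (h c))).
Qed.

Lemma esum_measure mu A (E : C -> set Omega) : (forall c, measurable (E c)) ->
  (\esum_(c in A) mu (E c) = \int[mu]_w (\esum_(c in A) (\1_(E c) w)%:E))%E.
Proof.
move=> mE; rewrite integral_esum//.
- by apply: eq_esum => c _; rewrite integral_indic// setIT.
- by move=> c; apply/measurable_EFinP; exact: measurable_indic.
Qed.

(** At each point [w] only the index [c = Z w] can contribute to the sum of the
    indicators of the events [Z = c]. *)
Lemma esum_law mu A Z : (forall c, measurable [set w | Z w = c]) ->
  (\esum_(c in A) mu [set w | Z w = c] = mu [set w | A (Z w)])%E.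
Proof.
move=> mZ; rewrite esum_measure//.
have mA := measurable_preimage A mZ.
rewrite -[X in _ = mu X]setIT -integral_indic//; apply: eq_integral => w _.
rewrite esum_mkcond (esumID [set Z w])//; last by move=> c _; case: ifP; rewrite ?lee_fin.
rewrite setTI esum_set1; last by case: ifP; rewrite ?lee_fin.
rewrite esum1 ?adde0//; last first.
  move=> c [_ /= cZ]; case: ifP => // _; rewrite indicE memNset//= => E.
  by apply: cZ.
rewrite !indicE (mem_set (erefl (Z w) : [set w' | Z w' = Z w] w)).
have -> : (w \in [set w | A (Z w)]) = (Z w \in A) by apply/idP/idP; rewrite !inE.
by case: ifP.
Qed.

End Countable.

Lemma ae_eq_measure {R : realType} {d : measure_display} {T : measurableType d}
    (mu : {measure set T -> \bar R}) (A B : set T) :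
  measurable A -> measurable B -> {ae mu, forall w, A w <-> B w} -> mu A = mu B.
Proof.
move=> mA mB AB; rewrite -(setIT A) -(setIT B) -!integral_indic//.
apply: ae_eq_integral => //; [exact/measurable_EFinP/measurable_indic..|].
apply: filterS AB => w AB _; rewrite !indicE; congr (_%:R%:E).
by congr nat_of_bool; apply/idP/idP; rewrite !inE => /AB.
Qed.

Lemma probability1_ae {R : realType} {d : measure_display} {T : measurableType d}
    (mu : probability T R) (A : set T) :
  measurable A -> mu A = 1%E -> {ae mu, forall w, A w}.
Proof.
move=> mA A1; apply/negligibleP; first exact: measurableC.
by change (mu (~` A) = 0%E); rewrite probability_setC// A1 subee.
Qed.

(** * Hitting times of a process *)

Section Chain.
Context {R : realType} {dS : Order.disp_t} {S : porderType dS} (e : S).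
Context {d : measure_display} {Omega : measurableType d}.
Variable X : nat -> Omega -> S.

(** This is [T_x - 1], with [None] for the value [+oo]; having countably many
    values, it makes everything computed from [T_x] measurable. *)
Definition first_hit (x : S) (w : Omega) : option nat :=
  if pselect (exists n, X n.+1 w == x) is left h then Some (ex_minn h) else None.

Variant first_hit_spec (x : S) (w : Omega) : option nat -> Prop :=
| FirstHit n of X n.+1 w = x & (forall m, (m < n)%N -> X m.+1 w <> x) :
    first_hit_spec x w (Some n)
| NoHit of (forall n, X n.+1 w <> x) : first_hit_spec x w None.

Lemma first_hitP x w : first_hit_spec x w (first_hit x w).
Proof.
rewrite /first_hit; case: pselect => [h|h].
  case: ex_minnP => n /eqP Xn nmin; constructor=> // m mn /eqP/nmin.
  by rewrite leqNgt mn.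
by constructor=> n Xn; apply: h; exists n; apply/eqP.
Qed.

Lemma first_hit_SomeE x n :
  [set w | first_hit x w = Some n] =
  [set w | X n.+1 w = x] `&` \bigcap_(m in [set m | (m < n)%N]) ~` [set w | X m.+1 w = x].
Proof.
apply/seteqP; split=> [w /=|w /= [Xn nmin]]; first by case: first_hitP => // m ? ? [<-].
case: first_hitP => [m Xm mmin|/(_ n)//]; congr Some.
have [mn|nm|//] := ltngtP m n; first by case: (nmin m mn).
by case: (mmin n nm).
Qed.

Lemma first_hit_NoneE x :
  [set w | first_hit x w = None] = \bigcap_n ~` [set w | X n.+1 w = x].
Proof.
apply/seteqP; split=> [w /=|w /= nX]; first by case: first_hitP => // nX _ n _; exact: nX.
by case: first_hitP => // n Xn _; case: (nX n).
Qed.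

Lemma hitting_timeE x w :
  hitting_time R X x w = if first_hit x w is Some n then n.+1%:R%:E else +oo%E.
Proof.
apply/eqP; rewrite eq_le; apply/andP; split.
  case: first_hitP => [n Xn _|_]; last exact: leey.
  by apply: ereal_inf_lbound; exists n.+1.
apply: le_ereal_inf_tmp => _ [m [m_gt0 Xm] <-]; case: m m_gt0 Xm => // m _ Xm.
case: first_hitP => [n _ nmin|/(_ m)//]; rewrite lee_fin ler_nat ltnS leqNgt.
by apply/negP => /nmin.
Qed.

(** The default [0] agrees with the junk value: [fine +oo] is [0], and so is the
    predecessor of its truncation. *)
Lemma before_returnE w : before_return R X e w = X (odflt 0%N (first_hit e w)) w.
Proof.
rewrite /before_return hitting_timeE; case: (first_hit e w) => [n|] /=.
  by rewrite natrK.
by rewrite (_ : (0 : R) = 0%:R)// natrK.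
Qed.

Hypothesis mX : forall n x, measurable [set w | X n w = x].

Lemma measurable_first_hit x (o : option nat) : measurable [set w | first_hit x w = o].
Proof.
case: o => [n|]; last first.
  by rewrite first_hit_NoneE; apply: bigcap_measurableType => n _; exact: measurableC.
rewrite first_hit_SomeE; apply: measurableI => //.
by apply: bigcap_measurableType => m _; exact: measurableC.
Qed.

Lemma measurable_hitting_time x : measurable_fun [set: Omega] (hitting_time R X x).
Proof.
have := measurable_comp_countable (countableP _)
  (fun o => if o is Some n then n.+1%:R%:E else +oo%E : \bar R)
  (measurable_first_hit x).
by congr measurable_fun; apply/funext => w; rewrite hitting_timeE.
Qed.

Lemma measurable_before_return y : measurable [set w | before_return R X e w = y].
Proof.
rewrite (_ : [set w | _] = \bigcup_o
    ([set w | first_hit e w = o] `&` [set w | X (odflt 0%N o) w = y])).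
  apply: countable_bigcupT_measurable => // o.
  by apply: measurableI => //; exact: measurable_first_hit.
apply/seteqP; split=> [w /=|w /= [i _ [fi Xy]]]; last by rewrite before_returnE fi.
by rewrite before_returnE; exists (first_hit e w).
Qed.

Definition follows (s : nat -> S) (n : nat) : set Omega :=
  [set w | forall k, (k <= n)%N -> X k w = s k].

Lemma measurable_follows s n : measurable (follows s n).
Proof.
rewrite (_ : follows s n = \bigcap_(k in [set k | (k <= n)%N]) [set w | X k w = s k]).
  by apply: bigcap_measurableType => k _.
by apply/seteqP; split.
Qed.

Lemma eq_follows s s' n : (forall k, (k <= n)%N -> s k = s' k) ->
  follows s n = follows s' n.
Proof.
by move=> E; apply/seteqP; split=> w H k kn; rewrite H// E.
Qed.

End Chain.
Arguments first_hit {dS S d Omega} X x w.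
Arguments follows {dS S d Omega} X s n.

(** * Excursions of an upward run chain *)

Section UpwardRun.
Context {R : realType} {dS : Order.disp_t} {S : porderType dS} (e : S).
Hypothesis hcountable : countable [set: S].
Hypothesis hmin : forall x : S, (e <= x)%O.
Hypothesis hchains : finite_chains e.
Hypothesis htree : rooted_tree e.
Context {d : measure_display} {Omega : measurableType d}.
Variables (Pr : S -> probability Omega R) (X : nat -> Omega -> S) (P : S -> S -> R).
Hypothesis hchain : markov_chain Pr X P.

Let mX n x : measurable [set w | X n w = x]. Proof. by case: hchain. Qed.
Let P_ge0 x y : 0 <= P x y. Proof. by case: hchain => /(_ x)[]. Qed.

Lemma Pr_follows x s n :
  (Pr x (follows X s n.+1) = Pr x (follows X s n) * (P (s n) (s n.+1))%:E)%E.
Proof. by case: hchain => _ _ _; exact. Qed.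

Lemma ae_start x : {ae Pr x, forall w, X 0%N w = x}.
Proof.
by apply: (probability1_ae (A := [set w | X 0%N w = x])) => //; case: hchain.
Qed.

(** A forbidden step at time [n] occurs together with one of the countably many
    histories of length [n + 2], and the Markov property makes each of those
    events null. *)
Lemma ae_step x n : {ae Pr x, forall w, 0 < P (X n w) (X n.+1 w)}.
Proof.
have /countable_injP[g ginj] := hcountable.
pose dec m : S := xget e [set s | g s = m].
have gK s : dec (g s) = s.
  by apply: ginj; rewrite ?inE//; apply: (@xgetPex _ e [set s' | g s' = g s]); exists s.
(* Histories are encoded by natural numbers, through sequences of codes of states. *)
pose hist (c : nat) k : S := dec (nth 0%N (odflt [::] (unpickle c)) k).
pose F c := if 0 < P (hist c n) (hist c n.+1) then set0 else follows X (hist c) n.+1.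
apply: (@negligibleS _ _ _ _ (\bigcup_c F c)).
  move=> w /= nP; exists (pickle [seq g (X k w) | k <- iota 0 n.+2]) => //.
  have histE k : (k < n.+2)%N ->
      hist (pickle [seq g (X k w) | k <- iota 0 n.+2]) k = X k w.
    move=> kn; rewrite /hist pickleK /= -[_ :: _]/(map _ (iota 0 n.+2)).
    by rewrite (nth_map 0%N) ?size_iota// nth_iota// gK.
  rewrite /F !histE//; case: ifP => // _ k kn.
  by rewrite histE.
apply: negligible_bigcup => c; rewrite /F; case: ifPn => [_|nP].
  exact: negligible_set0.
apply/negligibleP; first exact: measurable_follows.
apply: (etrans (Pr_follows x (hist c) n)); rewrite (_ : P _ _ = 0) ?mule0//.
by apply/eqP; move: nP; rewrite lt0r P_ge0 andbT negbK.
Qed.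

Hypothesis hupward : upward_run e P.
Hypothesis hrec : recurrent Pr X.

(** [n] is [T_e - 1], and the states visited before the return form the path of the
    tree to the last one of them. *)
Definition excursion (w : Omega) (n : nat) : Prop :=
  [/\ first_hit X e w = Some n, X 0%N w = e, X n.+1 w = e &
      tree_path e (X n w) = mkseq (fun k => X k.+1 w) n].

(** Before the return no state is [e], so every step of positive probability goes
    to a cover of the current state. *)
Lemma ae_excursion : {ae Pr e, forall w, exists n, excursion w n}.
Proof.
have aeT : {ae Pr e, forall w, (hitting_time R X e w < +oo)%E}.
  have mT : measurable [set w | (hitting_time R X e w < +oo)%E].
    rewrite (_ : [set w | _] = ~` [set w | first_hit X e w = None]).
      by apply: measurableC; exact: measurable_first_hit.
    apply/seteqP; split=> w /=; rewrite hitting_timeE; case: first_hit => //.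
    by move=> n _; exact: ltry.
  exact: (probability1_ae mT (hrec e)).
have aeS := ae_foralln (ae_step e).
apply: filterS3 aeT aeS (ae_start e) => w.
rewrite hitting_timeE /excursion; case: first_hitP => [n Xn nmin _ wS w0|_]; last first.
  by rewrite ltxx.
exists n; split=> //; apply/esym/(tree_path_uniq htree).
elim: n nmin {Xn} => [|n IH] nmin; first by [].
have [|pp pl] := IH; first by move=> m mn; apply: nmin; rewrite ltnS ltnW.
rewrite mkseqS; split; last by rewrite last_rcons.
rewrite rcons_path pp pl /=; apply/cover_edgeP.
by have /hupward[//|/(nmin n (ltnSn n))] := wS n.
Qed.

Local Notation Y := (before_return R X e).

Lemma excursion_before_return w n : excursion w n -> Y w = X n w.
Proof. by case=> h *; rewrite before_returnE h. Qed.

Lemma excursion_path w n k : excursion w n -> (k <= n)%N ->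
  nth e (e :: tree_path e (X n w)) k = X k w.
Proof.
by move=> [_ w0 _ ->]; case: k => [|k] kn //=; rewrite nth_mkseq.
Qed.

(** The state [x] is visited before the return iff it belongs to the path leading
    to the last state visited, that is, iff it is below that state. *)
Lemma excursion_hitting w n x : excursion w n ->
  (hitting_time R X x w <= hitting_time R X e w)%E <-> (x <= Y w)%O.
Proof.
move=> exc; rewrite (excursion_before_return exc).
have [->|xe] := eqVneq x e; first by rewrite hmin lexx.
have [he w0 Xe wp] := exc.
rewrite !hitting_timeE he (le_mem_tree_path hmin hchains htree) in_cons (negPf xe) /= wp.
case: first_hitP => [m Xm mmin|nX]; last first.
  rewrite leye_eq; split=> // /mapP[m _ xm].
  by case: (nX m).
rewrite lee_fin ler_nat ltnS; split=> [mn|/mapP[k + xk]].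
  rewrite -Xm; apply/mapP; exists m => //; rewrite mem_iota /= add0n ltn_neqAle mn andbT.
  by apply: contra_neq xe => mn'; rewrite -Xm mn'.
rewrite mem_iota /= add0n => kn; apply: leq_trans (ltnW kn).
by rewrite leqNgt; apply/negP => /mmin; rewrite -xk.
Qed.

Lemma excursion_time w n : excursion w n ->
  hitting_time R X e w = (1 + (tree_dist e (Y w))%:R%:E)%E.
Proof.
move=> exc; rewrite (excursion_before_return exc); have [he _ _ wp] := exc.
rewrite hitting_timeE he /tree_dist -/(tree_path e _) wp size_mkseq.
by rewrite -EFinD mulrS.
Qed.

(** The last state visited is above [x] iff the excursion starts with the path to
    [x].  Conversely, following this path takes place before the return, since [e]
    does not occur on it again. *)
Lemma excursion_follows w n x : excursion w n ->
  (x <= Y w)%O <-> follows X (nth e (e :: tree_path e x)) (size (tree_path e x)) w.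
Proof.
move=> exc; rewrite (excursion_before_return exc); split=> [|wx].
  move=> /(le_cover_path hmin hchains)[p pp pE].
  have wn k : (k <= n)%N -> nth e (e :: tree_path e x ++ p) k = X k w.
    by rewrite -(tree_path_cat htree pp) pE; exact: excursion_path.
  move=> k kx.
  have kn : (k <= n)%N.
    have [_ _ _ /(congr1 size)] := exc.
    rewrite -pE (tree_path_cat htree pp) size_cat size_mkseq => <-.
    by rewrite (leq_trans kx) ?leq_addr.
  by rewrite -wn// -cat_cons nth_cat /= ltnS kx.
have Xx : X (size (tree_path e x)) w = x.
  by rewrite wx// nth_last /= (last_tree_path htree).
(* Otherwise the path to [x] would contain [e] at position [n.+1]. *)
have xn : (size (tree_path e x) <= n)%N.
  rewrite leqNgt; apply/negP => nx; have [_ _ Xe _] := exc.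
  have : nth e (e :: tree_path e x) n.+1 == nth e (e :: tree_path e x) 0.
    by rewrite -wx ?Xe.
  by rewrite nth_uniq ?(uniq_tree_path htree)//= ltnS.
rewrite (le_mem_tree_path hmin hchains htree) -[X in X \in _]Xx -(excursion_path exc)//.
have [_ _ _ wp] := exc.
by rewrite mem_nth//= wp size_mkseq ltnS.
Qed.

Let mY y : measurable [set w | Y w = y]. Proof. exact: measurable_before_return. Qed.

Let mYge x : measurable [set w | (x <= Y w)%O].
Proof. exact: (measurable_preimage hcountable [set y | (x <= y)%O] mY). Qed.

(** * Upper probabilities and the return time *)

Lemma std_invariant_upper x : std_invariant Pr X e x = Pr e [set w | (x <= Y w)%O].
Proof.
apply: ae_eq_measure => //.
  have := measurable_lee measurableT
    (measurable_hitting_time (R := R) mX x) (measurable_hitting_time (R := R) mX e).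
  by rewrite setTI.
by apply: filterS ae_excursion => w [n exc]; exact: excursion_hitting exc.
Qed.

Lemma expected_return_time :
  (\int[Pr e]_w hitting_time R X e w =
   \int[Pr e]_w (1 + (tree_dist e (Y w))%:R%:E))%E.
Proof.
apply: ae_eq_integral => //.
- exact: measurable_hitting_time.
- exact: (measurable_comp_countable hcountable
    (fun y => 1 + (tree_dist e y)%:R%:E : \bar R)%E mY).
- by apply: filterS ae_excursion => w [n exc] _; exact: excursion_time exc.
Qed.

Lemma esum_upper :
  (\esum_(x in [set: S]) Pr e [set w | (x <= Y w)%O] =
   \int[Pr e]_w (1 + (tree_dist e (Y w))%:R%:E))%E.
Proof.
rewrite esum_measure//; apply: eq_integral => w _.
rewrite -esum_below//; apply: eq_esum => x _; rewrite indicE.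
by case: ifPn => xY; [rewrite mem_set|rewrite memNset//; exact/negP].
Qed.

Lemma integral_tree_dist :
  (\int[Pr e]_w (1 + (tree_dist e (Y w))%:R%:E) =
   1 + 'E_(Pr e)[fun w => (tree_dist e (Y w))%:R])%E.
Proof.
rewrite ge0_integralD//; last first.
  exact: (measurable_comp_countable hcountable
    (fun y => (tree_dist e y)%:R%:E : \bar R) mY).
rewrite integral_cst// mul1e unlock; congr (_ + _)%E.
exact: probability_setT.
Qed.

(** * Invariant densities *)

Lemma upper_root : Pr e [set w | (e <= Y w)%O] = 1%E.
Proof.
rewrite (_ : [set w | _] = setT) ?probability_setT//.
by apply/seteqP; split=> // w _ /=; exact: hmin.
Qed.

(** This turns the upper probability at [x] into the probability of a finite
    history, to which the Markov property applies. *)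
Lemma upper_follows x : Pr e [set w | (x <= Y w)%O] =
  Pr e (follows X (nth e (e :: tree_path e x)) (size (tree_path e x))).
Proof.
apply: ae_eq_measure => //; first exact: measurable_follows.
by apply: filterS ae_excursion => w [n exc]; exact: excursion_follows exc.
Qed.

(** The path to [y] is the path to [x] followed by one step. *)
Lemma upper_cover x y : cover_set x y ->
  (Pr e [set w | (y <= Y w)%O] = Pr e [set w | (x <= Y w)%O] * (P x y)%:E)%E.
Proof.
move=> xy; rewrite !upper_follows (tree_path_cover htree xy) size_rcons.
have pre k : (k <= size (tree_path e x))%N ->
    nth e (e :: rcons (tree_path e x) y) k = nth e (e :: tree_path e x) k.
  by move=> kx; rewrite -rcons_cons nth_rcons /= ltnS kx.
rewrite Pr_follows (eq_follows _ pre) pre//.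
by rewrite [in P _ _]/= nth_rcons ltnn eqxx nth_last /= (last_tree_path htree).
Qed.

Lemma upper_gt0 x : (0 < Pr e [set w | (x <= Y w)%O])%E.
Proof.
move: x; apply: (tree_ind htree); first by rewrite upper_root lte01.
move=> x y xy x0; rewrite (upper_cover xy) mule_gt0// lte_fin.
by apply/hupward; left.
Qed.

(** As [y] is not [e], it is entered only from elements that it covers, and [x] is
    the only one of them in a tree. *)
Lemma invariant_cover (f : S -> R) x y :
  invariant_density P f -> cover_set x y -> f y = f x * P x y.
Proof.
move=> [[f0 _] finv] xy.
have fP z : (0 <= (f z * P z y)%:E)%E by rewrite lee_fin mulr_ge0.
apply: EFin_inj; rewrite -finv (esumID [set x])// setTI esum_set1// esum1 ?adde0//.
move=> z [_ /= zx]; have [zy|] := ltP 0 (P z y).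
  have [/(cover_parent htree xy)/esym//|ye] := (hupward z y).1 zy.
  by have := cover_lt xy; rewrite ye le_gtF.
by move=> Pz; rewrite (_ : P z y = 0) ?mulr0//; apply/eqP; rewrite eq_le Pz P_ge0.
Qed.

(** Both sides satisfy the same recursion along the tree, and they agree at [e]. *)
Lemma invariant_upper (f : S -> R) x : invariant_density P f ->
  ((f x)%:E = (f e)%:E * Pr e [set w | (x <= Y w)%O])%E.
Proof.
move=> fi; move: x; apply: (tree_ind htree); first by rewrite upper_root mule1.
by move=> x y xy IH; rewrite (upper_cover xy) muleA -IH (invariant_cover fi xy).
Qed.

Lemma invariant_root_gt0 (f : S -> R) : invariant_density P f -> 0 < f e.
Proof.
move=> fi; have [[f0 f1] _] := fi; rewrite lt0r f0 andbT; apply/eqP => fe0.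
move: f1; rewrite esum1 => [/esym/eqP|x _]; first by rewrite onee_eq0.
by rewrite (invariant_upper x fi) fe0 mul0e.
Qed.

(** With [U] for the upper probability function of [Y], [f = f(e) U].  If [f] is the
    density of [Y], its upper probability function is [U] and its rate is [f(e)].
    If the rate is constant, its value at [e] is [f(e)], which forces the upper
    probability function of [f] to be [U] too; then [esum_above], whose sums are
    finite, gives the same value [U x - s] to both densities at [x]. *)
Lemma before_return_density_constant_rate (f : S -> R) : invariant_density P f ->
  (forall x, (f x)%:E = Pr e [set w | Y w = x]) <-> constant_rate f.
Proof.
move=> fi; have fe0 := invariant_root_gt0 fi; have [[f0 f1] _] := fi.
pose U x := fine (Pr e [set w | (x <= Y w)%O]).
have UE x : Pr e [set w | (x <= Y w)%O] = (U x)%:E.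
  by rewrite fineK// fin_num_measure.
have U0 x : 0 < U x by rewrite -lte_fin -UE upper_gt0.
have fU x : f x = f e * U x.
  by apply: EFin_inj; rewrite (invariant_upper x fi) UE.
have upE x : (\esum_(t in [set t | (x <= t)%O]) Pr e [set w | Y w = t] = (U x)%:E)%E.
  by rewrite -UE; exact: esum_law.
split=> [fY|[c fc]].
  exists (f e) => x; rewrite /rate /upper_prob.
  rewrite (eq_esum (b := fun t => Pr e [set w | Y w = t])); last by move=> t _; exact: fY.
  by rewrite upE fU mulfK// gt_eqF.
have ce : c = f e.
  rewrite -(fc e) /rate /upper_prob (_ : [set y | _] = setT) ?f1 ?divr1//.
  by apply/seteqP; split=> // y _ /=; exact: hmin.
have fup x : (\esum_(t in [set t | (x <= t)%O]) (f t)%:E = (U x)%:E)%E.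
  have le1 : (\esum_(t in [set t | (x <= t)%O]) (f t)%:E <= 1)%E.
    rewrite -f1 esum_mkcond; apply: le_esum => t _; case: ifP => // _.
    by rewrite lee_fin.
  have fin : (\esum_(t in [set t | (x <= t)%O]) (f t)%:E)%E \is a fin_num.
    rewrite ge0_fin_numE ?(le_lt_trans le1) ?ltry//.
    by apply: esum_ge0 => t _; rewrite lee_fin.
  rewrite -(fineK fin) -/(upper_prob f x); congr _%:E.
  have := fc x; rewrite /rate ce => fx.
  have u0 : upper_prob f x != 0.
    by apply: contra_eq_neq fx => ->; rewrite invr0 mulr0 lt_eqF.
  apply: (mulfI (lt0r_neq0 fe0)); rewrite -fU.
  by rewrite -fx mulfVK.
move=> x.
pose s := (\esum_(y in cover_set x) (U y)%:E)%E.
have Uf : ((U x)%:E = (f x)%:E + s)%E.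
  rewrite -fup (esum_above hmin hchains htree)//; congr (_ + _)%E.
  by apply: eq_esum => y _; exact: fup.
have UY : ((U x)%:E = Pr e [set w | Y w = x] + s)%E.
  rewrite -upE (esum_above hmin hchains htree)//; congr (_ + _)%E.
  by apply: eq_esum => y _; exact: upE.
have s0 : (0 <= s)%E by apply: esum_ge0 => y _; rewrite lee_fin ltW.
have sfin : s \is a fin_num.
  rewrite ge0_fin_numE//; apply: (@le_lt_trans _ _ (U x)%:E); last exact: ltry.
  by rewrite Uf leeDr// lee_fin.
by rewrite -(addeK (f x)%:E sfin) -Uf UY addeK.
Qed.

End UpwardRun.

Theorem mainTheorem9
  (R : realType) (dS : Order.disp_t) (S : porderType dS) (e : S)
  (hcountable : countable [set: S])
  (hmin : forall x : S, (e <= x)%O)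
  (hchains : finite_chains e)
  (htree : rooted_tree e)
  (d : measure_display) (Omega : measurableType d)
  (Pr : S -> probability Omega R) (X : nat -> Omega -> S)
  (P : S -> S -> R)
  (hchain : markov_chain Pr X P)
  (hupward : upward_run e P)
  (hrec : recurrent Pr X) :
  (forall x : S,
     std_invariant Pr X e x = Pr e [set w | (x <= before_return R X e w)%O])
  /\
  ((\int[Pr e]_w hitting_time R X e w =
      \esum_(x in [set: S]) std_invariant Pr X e x)%E
   /\
   (\esum_(x in [set: S]) std_invariant Pr X e x =
      1 + 'E_(Pr e)[fun w => (tree_dist e (before_return R X e w))%:R])%E)
  /\
  (positive_recurrent Pr X ->
   forall f : S -> R, invariant_density P f ->
     ((forall x : S, (f x)%:E = Pr e [set w | before_return R X e w = x])
      <-> constant_rate f)).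
Proof.
have F_upper := std_invariant_upper hcountable hmin hchains htree hchain hupward hrec.
have sumF : (\esum_(x in [set: S]) std_invariant Pr X e x =
    \int[Pr e]_w (1 + (tree_dist e (before_return R X e w))%:R%:E))%E.
  rewrite -(esum_upper hcountable hmin hchains htree hchain).
  by apply: eq_esum => x _; exact: F_upper.
split; [exact: F_upper|split; [split|]].
- by rewrite sumF (expected_return_time hcountable htree hchain hupward hrec).
- by rewrite sumF (integral_tree_dist e hcountable hchain).
- move=> _ f.
  exact: (before_return_density_constant_rate hcountable hmin hchains htree hchain hupward hrec).
Qed.
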